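(* Let $\pi$ be a probability measure on $\mathbb R^d$ with $\pi(dx)=\varrho(x)\,dx$ and $\varrho\in L^\infty(\mathbb R^d)$. If $g\in C^1(\mathbb R^d)\cap L_0^2(\pi)$ and $\nabla g\in L^4(\mathbb R^d,dx)$, then $M(|\nabla g|)\in L^4(\pi)$, i.e. $g$ belongs to the class $$\mathcal G_{\nabla,\pi}:=\{g\in C^1(\mathbb R^d)\cap L_0^2(\pi):\ M(|\nabla g|)\in L^4(\pi)\}.$$
   Context: $L_0^2(\pi)=\{g\in L^2(\pi):\int g\,d\pi=0\}$. Hardy--Littlewood maximal function: $Mh(x)=\sup_{t>0}\frac1{|B(x,t)|}\int_{B(x,t)}|h(z)|\,dz$, where $B(x,t)$ is the Euclidean ball of radius $t$ centered at $x$ and $|B(x,t)|$ its Lebesgue volume. $|\cdot|$ applied to $\nabla g$ is the Euclidean norm. *)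

(* Defs.v *)
From HB Require Import structures.
From mathcomp Require Import all_boot all_order all_algebra.
From mathcomp Require Import all_classical all_reals all_analysis.
From mathcomp Require Import measurable_realfun.

Set Implicit Arguments.
Unset Strict Implicit.
Unset Printing Implicit Defensive.
Import Order.TTheory GRing.Theory Num.Theory.
Import numFieldNormedType.Exports.

Local Open Scope classical_set_scope.
Local Open Scope ring_scope.

(* R^d is ['rV[R]_d].  The library norm on it is the sup norm, used here only
   through the topology and the derivative; Euclidean lengths are [enorm]. *)

(* ['rV[R]_d] carries the Borel sigma-algebra of its topology. *)
Definition borel_rV_display : measure_display.
Proof. exact: default_measure_display. Qed.

Section borel_rV.
Context {R : realType} {d : nat}.

Let borel0 : <<s @open 'rV[R]_d >> set0.
Proof. exact: sigma_algebra0. Qed.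

Let borelC A : <<s @open 'rV[R]_d >> A -> <<s @open 'rV[R]_d >> (~` A).
Proof. exact: sigma_algebraC. Qed.

Let borel_bigcup (F : (set 'rV[R]_d)^nat) :
  (forall i, <<s @open 'rV[R]_d >> (F i)) ->
  <<s @open 'rV[R]_d >> (\bigcup_i (F i)).
Proof. exact: sigma_algebra_bigcup. Qed.

HB.instance Definition _ := @isMeasurable.Build
  borel_rV_display 'rV[R]_d <<s @open 'rV[R]_d >>
  borel0 borelC borel_bigcup.

Lemma measurable_coord_rV (i : 'I_d) :
  measurable_fun setT (fun v : 'rV[R]_d => v ord0 i).
Proof.
apply: (measurability _ (RGenOpens.measurableE R)).
move=> _ [_ [a [b ->]] <-]; rewrite setTI; apply: sub_sigma_algebra.
apply: open_comp => [v _|]; last exact: interval_open.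
exact: coord_continuous.
Qed.

Lemma measurable_fun_rVP d' (T : measurableType d') (f : T -> 'rV[R]_d) :
  (forall i, measurable_fun setT (fun t => f t ord0 i)) ->
  measurable_fun setT f.
Proof.
move=> mf; apply: (@measurability _ _ _ _ setT f (@open 'rV[R]_d)) => //.
move=> _ [A oA <-]; rewrite setTI.
pose B (p : {ffun 'I_d -> rat} * nat) : set 'rV[R]_d :=
  [set v | forall i, `|ratr (p.1 i) - v ord0 i| < p.2.+1%:R^-1].
have AE : A = \bigcup_(p in [set p | B p `<=` A]) B p.
  apply/seteqP; split => [v Av|v [p /= + Bv]]; last exact.
  have /nbhs_ballP[e /= e0 eA] : nbhs v A by exact: open_nbhs_nbhs.
  have [n ne] : exists n, n.+1%:R^-1 < e / 2.
    have e20 : 0 < e / 2 by rewrite divr_gt0.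
    exists (Num.truncn (e / 2)^-1).
    by rewrite invf_plt ?posrE// truncnS_gt.
  have /choice[q qP] : forall i, exists q : rat,
      `|ratr q - v ord0 i| < n.+1%:R^-1 :> R.
    move=> i; have n0 : v ord0 i < v ord0 i + n.+1%:R^-1 by rewrite ltrDl.
    have [q] := rat_in_itvoo n0; rewrite in_itv/= => /andP[h1 h2].
    by exists q; rewrite gtr0_norm ?subr_gt0// ltrBlDr addrC.
  exists ([ffun i => q i], n) => /=; last by move=> i; rewrite ffunE.
  move=> w Bw; apply: eA; split => // j i.
  rewrite (ord1 j); move: (Bw i); rewrite ffunE/= => Bwi.
  rewrite /ball/= (le_lt_trans (ler_distD (ratr (q i)) _ _))//.
  rewrite (splitr e) ltrD//; last exact: lt_trans ne.
  by rewrite distrC; exact: lt_trans ne.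
rewrite AE preimage_bigcup bigcup_mkcond.
apply: countable_bigcupT_measurable => // p; case: ifP => // _.
rewrite (_ : _ @^-1` _ = \bigcap_(i in [set: 'I_d])
    (fun t => `|ratr (p.1 i) - f t ord0 i|) @^-1` `]-oo, p.2.+1%:R^-1[).
  apply: fin_bigcap_measurable => // i _.
  rewrite -[X in measurable X]setTI.
  have mg : measurable_fun setT (fun t => `|ratr (p.1 i) - f t ord0 i|).
    apply: measurableT_comp => //; exact: measurable_funB.
  exact: mg.
by apply/seteqP; split => t /= h i => [_|]; have := h i; rewrite /= in_itv/=; apply.
Qed.

End borel_rV.

Section lebesgue_rV.
Context {R : realType}.

Definition cons_rV n (p : measurableTypeR R * 'rV[R]_n) : 'rV[R]_n.+1 :=
  \row_i oapp (fun j => p.2 ord0 j) p.1 (unlift ord0 i).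

Lemma measurable_cons_rV n : measurable_fun setT (@cons_rV n).
Proof.
apply: measurable_fun_rVP => i; case: (unliftP ord0 i) => [j ->|->].
  under eq_fun do rewrite mxE liftK/=.
  apply: (measurableT_comp (measurable_coord_rV j)); exact: measurable_snd.
under eq_fun do rewrite mxE unlift_none/=.
exact: measurable_fst.
Qed.

Definition lebesgue_cons n (m : {sigma_finite_measure set 'rV[R]_n -> \bar R}) :
    set 'rV[R]_n.+1 -> \bar R :=
  pushforward (@lebesgue_measure R \x m)%E (@cons_rV n).

Section lebesgue_cons_measure.
Context n (m : {sigma_finite_measure set 'rV[R]_n -> \bar R}).

Let mcons A : measurable A -> measurable (@cons_rV n @^-1` A).
Proof.
by move=> mA; rewrite -[X in measurable X]setTI; exact: measurable_cons_rV.
Qed.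

Let lebesgue_cons0 : lebesgue_cons m set0 = 0%E.
Proof. by rewrite /lebesgue_cons /pushforward preimage_set0 measure0. Qed.

Let lebesgue_cons_ge0 A : (0 <= lebesgue_cons m A)%E.
Proof. by rewrite /lebesgue_cons /pushforward; exact: measure_ge0. Qed.

Let lebesgue_cons_sigma_additive : semi_sigma_additive (lebesgue_cons m).
Proof.
move=> F mF tF mUF; rewrite /lebesgue_cons /pushforward preimage_bigcup.
apply: measure_semi_sigma_additive.
- by move=> k; exact: mcons.
- apply/trivIsetP => /= i j _ _ ij; rewrite -preimage_setI.
  by move/trivIsetP : tF => /(_ _ _ _ _ ij) ->//; rewrite preimage_set0.
- by rewrite -preimage_bigcup; exact: mcons.
Qed.

HB.instance Definition _ := isMeasure.Build _ _ _ (lebesgue_cons m)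
  lebesgue_cons0 lebesgue_cons_ge0 lebesgue_cons_sigma_additive.

Let sigma_finite_prod : sigma_finite setT (@lebesgue_measure R \x m)%E.
Proof.
have /sigma_finiteP[F [TF ndF Foo]] := sigma_finiteT (@lebesgue_measure R).
have /sigma_finiteP[G [TG ndG Goo]] := sigma_finiteT m.
exists (fun k => F k `*` G k).
  rewrite -setXTT TF TG; apply/seteqP; split=> [[x y] /= [[k _ Fx] [l _ Gy]]|].
    exists (maxn k l) => //; split.
    - by move: x Fx; exact/subsetPset/ndF/leq_maxl.
    - by move: y Gy; exact/subsetPset/ndG/leq_maxr.
  by move=> [x y] [k _ [/= Fx Gy]]; split; exists k.
move=> k; have [mF Fk] := Foo k; have [mG Gk] := Goo k.
split; first exact: measurableX.
by rewrite product_measure1E// lte_mul_pinfty// ge0_fin_numE.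
Qed.

Let lebesgue_cons_sigma_finite : sigma_finite setT (lebesgue_cons m).
Proof.
have [F TF Foo] := sigma_finite_prod.
pose g (v : 'rV[R]_n.+1) : measurableTypeR R * 'rV[R]_n := (v ord0 ord0, \row_j v ord0 (lift ord0 j)).
have mg : measurable_fun setT g.
  apply/measurable_fun_pairP; split; first exact: measurable_coord_rV.
  apply: measurable_fun_rVP => i /=; under eq_fun do rewrite mxE.
  exact: measurable_coord_rV.
have gK : cancel (@cons_rV n) g.
  move=> [a v]; rewrite /g/cons_rV !mxE unlift_none/=; congr pair.
  by apply/rowP => j; rewrite !mxE liftK.
exists (fun k => g @^-1` F k); first by rewrite -preimage_bigcup -TF preimage_setT.
move=> k; have [mF Fk] := Foo k; split; first by rewrite -[X in measurable X]setTI; exact: mg.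
rewrite /lebesgue_cons /pushforward -comp_preimage.
by rewrite (_ : g \o @cons_rV n = id)//; apply/funext => x /=; rewrite gK.
Qed.

HB.instance Definition _ := Measure_isSigmaFinite.Build _ _ _ (lebesgue_cons m)
  lebesgue_cons_sigma_finite.

End lebesgue_cons_measure.

(* d-fold product of the one-dimensional Lebesgue measure, carried along
   [cons_rV : R * R^n -> R^n.+1]; [lebesgue_rV_box] characterizes it. *)
Fixpoint lebesgue_rV (d : nat) : {sigma_finite_measure set 'rV[R]_d -> \bar R} :=
  match d with
  | 0%N => \d_(0 : 'rV[R]_0)
  | n.+1 => lebesgue_cons (lebesgue_rV n)
  end.

Lemma lebesgue_rV_box d (A : 'I_d -> set R) : (forall i, measurable (A i)) ->
  lebesgue_rV d [set v | forall i, A i (v ord0 i)] =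
  (\prod_(i < d) lebesgue_measure (A i))%E.
Proof.
elim: d A => [|d IH] A mA.
  by rewrite big_ord0 /= diracE mem_set// => -[].
rewrite big_ord_recl /= /lebesgue_cons /pushforward.
rewrite (_ : _ @^-1` _ =
    A ord0 `*` [set v : 'rV[R]_d | forall i, A (lift ord0 i) (v ord0 i)]).
  rewrite product_measure1E.
  - by congr (_ * _)%E; apply: IH => i; exact: mA.
  - exact: mA.
  - rewrite (_ : [set _ | _] = \bigcap_(i in [set: 'I_d])
      (setT `&` (fun v : 'rV[R]_d => v ord0 i) @^-1` A (lift ord0 i))).
      apply: fin_bigcap_measurable => // i _.
      by apply: measurable_coord_rV => //; exact: mA.
    by apply/seteqP; split => v /= h i => [_|]; [split|have [] := h i Logic.I].
apply/seteqP; split => -[a v] /=.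
  move=> h; split; first by have := h ord0; rewrite mxE unlift_none.
  by move=> i; have := h (lift ord0 i); rewrite mxE liftK.
by move=> [Aa h] i; rewrite mxE; case: unliftP => [j ->|->].
Qed.

End lebesgue_rV.

Section calculus.
Context {R : realType} {d : nat}.
Implicit Types (v x : 'rV[R]_d) (g : 'rV[R]_d -> R).

Definition enorm v : R := Num.sqrt (\sum_(i < d) v ord0 i ^+ 2).

(* The sup-norm [ball] of the library is not the Euclidean ball. *)
Definition eball x (t : R) : set 'rV[R]_d := [set z | enorm (z - x) < t].

Definition grad g x : 'rV[R]_d := \row_i 'D_(delta_mx ord0 i) g x.

Definition C1 g : Prop := (forall x, differentiable g x) /\ continuous (grad g).

Definition HL_maximal_rV (h : 'rV[R]_d -> R) x : \bar R :=
  ereal_sup [set ((lebesgue_rV d (eball x t))^-1 *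
    \int[lebesgue_rV d]_(z in eball x t) `|h z|%:E)%E | t in `]0, +oo[%classic].

End calculus.

(* Membership in L^p for [\bar R]-valued functions: the library's [Lfun] is
   restricted to real-valued ones, and a maximal function may take value +oo. *)
Definition eLfun d (T : measurableType d) (R : realType)
    (mu : {measure set T -> \bar R}) (p : \bar R) : set (T -> \bar R) :=
  [set f : T -> \bar R | measurable_fun [set: T] f /\ ('N[mu]_p[f] < +oo)%E].

Section classes.
Context {R : realType} {d : nat}.
Variable pi : probability 'rV[R]_d R.

Definition L20 : set ('rV[R]_d -> R) :=
  [set g | g \in Lfun pi 2%:E /\ (\int[pi]_x (g x)%:E = 0)%E].

Definition G_grad : set ('rV[R]_d -> R) :=
  [set g | [/\ C1 g, L20 g &
               eLfun pi 4%:E (HL_maximal_rV (enorm \o grad g))]].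

End classes.

(* Main.v *)
(* A bounded density gives [pi A <= K |A|], so only Lebesgue measure matters, and
   the claim reduces to the L^4 bound for the maximal function of
   [h = |grad g|].  [M h] is lower semicontinuous, hence measurable.  A Euclidean
   ball has volume comparable to that of the sup-norm ball of the same radius, so
   [{M h > 2 c b}], with [c = (2 (d + 1)) ^ d], is covered by countably many
   rational sup-norm balls whose average of [h 1_{h > b}] is at least [b];
   Vitali's covering argument then yields
   [b |{M h > 2 c b}| <= 3 ^ d * \int_{h > b} h].  Since [pi] is finite, bounding
   [(M h) ^ 4] by [1 + \sum_k 16 ^ (k + 1) 1_{M h > 2 ^ k}] and summing over the
   natural numbers [k] gives [\int (M h) ^ 4 dpi <= 1 + D \int h ^ 4]. *)

Require Import Defs.
From mathcomp Require Import all_boot all_order all_algebra.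
From mathcomp Require Import all_classical all_reals all_analysis.
From mathcomp Require Import measurable_realfun ess_sup_inf.
From mathcomp Require Import ring lra.
Import Order.TTheory GRing.Theory Num.Theory.
Import numFieldNormedType.Exports.

Set Implicit Arguments.
Unset Strict Implicit.
Unset Printing Implicit Defensive.

Local Open Scope classical_set_scope.
Local Open Scope ring_scope.

(** * The Euclidean norm, and Euclidean balls against sup-norm balls *)

Section euclidean_norm.
Context {R : realType} {d : nat}.
Implicit Types (u v x y : 'rV[R]_d) (t r : R).

Lemma enorm_ge0 v : 0 <= enorm v.
Proof. exact: sqrtr_ge0. Qed.

Lemma sqr_enorm v : enorm v ^+ 2 = \sum_(i < d) v ord0 i ^+ 2.
Proof. by rewrite sqr_sqrtr// sumr_ge0// => i _; exact: sqr_ge0. Qed.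

Lemma normr_coord_le_enorm v i : `|v ord0 i| <= enorm v.
Proof.
rewrite -(@ler_pXn2r _ 2)// ?nnegrE ?enorm_ge0// sqr_enorm real_normK ?num_real//.
by rewrite (bigD1 i)//= lerDl sumr_ge0// => j _; exact: sqr_ge0.
Qed.

(** A sum of [d] squares, each at most [(t / d.+1) ^ 2], stays below [t ^ 2] since [d < d.+1 ^ 2].
    Dividing by [d.+1] covers dimension 0 as well. *)
Lemma enorm_lt v t : 0 < t ->
  (forall i, `|v ord0 i| < t / d.+1%:R) -> enorm v < t.
Proof.
move=> t0 vt; rewrite -(@ltr_pXn2r _ 2)// ?nnegrE ?enorm_ge0 ?ltW// sqr_enorm.
have td0 : 0 < t / d.+1%:R by rewrite divr_gt0.
apply: (@le_lt_trans _ _ (\sum_(i < d) (t / d.+1%:R) ^+ 2)).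
  apply: ler_sum => i _; rewrite -real_normK ?num_real//.
  by rewrite lerXn2r ?nnegrE ?(ltW td0)// ltW.
rewrite sumr_const card_ord -[ltLHS]mulr_natr expr_div_n -mulrA gtr_pMr ?exprn_gt0//.
rewrite mulrC ltr_pdivrMr ?exprn_gt0// mul1r -natrX ltr_nat.
by rewrite expnS expn1 leq_pmulr.
Qed.

Lemma enormD u v : enorm (u + v) <= enorm u + enorm v.
Proof.
(* The weights [b / a] and [a / b] below require nonzero norms, so vanishing vectors are treated
   first. *)
have [u0|u0] := eqVneq (enorm u) 0.
  suff -> : u = 0 by rewrite add0r lerDr enorm_ge0.
  apply/rowP => i; apply/eqP; rewrite mxE -normr_le0 -u0.
  exact: normr_coord_le_enorm.
have [v0|v0] := eqVneq (enorm v) 0.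
  suff -> : v = 0 by rewrite addr0 lerDl enorm_ge0.
  apply/rowP => i; apply/eqP; rewrite mxE -normr_le0 -v0.
  exact: normr_coord_le_enorm.
have {}u0 : 0 < enorm u by rewrite lt0r u0 enorm_ge0.
have {}v0 : 0 < enorm v by rewrite lt0r v0 enorm_ge0.
rewrite -(@ler_pXn2r _ 2)// ?nnegrE ?addr_ge0 ?enorm_ge0//.
set a := enorm u in u0 *; set b := enorm v in v0 *.
(* AM-GM: [2 u_i v_i <= (b / a) u_i ^ 2 + (a / b) v_i ^ 2] *)
rewrite sqr_enorm (@le_trans _ _ (\sum_(i < d)
    ((1 + b / a) * u ord0 i ^+ 2 + (1 + a / b) * v ord0 i ^+ 2)))//.
  apply: ler_sum => i _; rewrite mxE.
  set p := u _ _; set q := v _ _; rewrite -subr_ge0.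
  rewrite (_ : _ - _ = (b * p - a * q) ^+ 2 / (a * b)); last first.
    by clearbody p q a b; field; rewrite !gt_eqF.
  by rewrite divr_ge0 ?sqr_ge0// mulr_ge0// ltW.
rewrite big_split/= -!mulr_sumr -!sqr_enorm -/a -/b.
rewrite [leLHS](_ : _ = (a + b) ^+ 2)//.
by clearbody a b; field; rewrite !gt_eqF.
Qed.

Lemma enorm_distC u v : enorm (u - v) = enorm (v - u).
Proof.
by congr Num.sqrt; apply: eq_bigr => i _; rewrite !mxE -sqrrN opprB.
Qed.

Lemma measurable_enorm : measurable_fun [set: 'rV[R]_d] (@enorm R d).
Proof.
apply: (measurableT_comp (continuous_measurable_fun (@sqrt_continuous R))).
apply: measurable_sum => i; apply: measurable_funX.
exact: measurable_coord_rV.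
Qed.

Lemma open_measurable_rV (A : set 'rV[R]_d) : open A -> measurable A.
Proof. exact: sub_sigma_algebra. Qed.

Lemma measurable_ball_rV x r : measurable (ball x r).
Proof.
have [r0|r0] := ltP 0 r; first by apply: open_measurable_rV; exact: ball_open.
(* Membership in a sup-norm ball of row vectors includes positivity of the radius. *)
by rewrite (_ : ball x r = set0)// -subset0 => y [+ _]; rewrite ltNge r0.
Qed.

Lemma measurable_eball x t : measurable (eball x t).
Proof.
rewrite (_ : eball x t = (fun z => enorm (z - x)) @^-1` `]-oo, t[).
  rewrite -[X in measurable X]setTI.
  suff : measurable_fun [set: 'rV[R]_d] (fun z => enorm (z - x)) by exact.
  apply: (measurableT_comp measurable_enorm).
  apply: measurable_fun_rVP => i; under eq_fun do rewrite !mxE.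
  apply: measurable_funB; last exact: measurable_cst.
  exact: measurable_coord_rV.
by apply/seteqP; split => z /=; rewrite in_itv.
Qed.

Lemma eball_sub_ball x t : eball x t `<=` ball x t.
Proof.
move=> z; rewrite /eball/= => xzt; split.
  exact: le_lt_trans (enorm_ge0 _) xzt.
move=> i j; rewrite (ord1 i) /ball/= distrC.
by apply: le_lt_trans xzt; have := normr_coord_le_enorm (z - x) j; rewrite !mxE.
Qed.

Lemma ball_sub_eball x t : 0 < t -> ball x (t / d.+1%:R) `<=` eball x t.
Proof.
move=> t0 z [_ xz]; rewrite /eball/=; apply: enorm_lt => // i.
by rewrite !mxE distrC; exact: xz.
Qed.

Lemma eball_subset x y s t : enorm (x - y) + s <= t -> eball x s `<=` eball y t.
Proof.
move=> xyst z; rewrite /eball/= => xz; rewrite -(subrKA x).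
by rewrite (le_lt_trans (enormD _ _))// (lt_le_trans _ xyst)// addrC ltrD2l.
Qed.

End euclidean_norm.

(** * Volumes of sup-norm and Euclidean balls *)

Section volume.
Context {R : realType} {d : nat}.
Local Notation mu := (@lebesgue_rV R d).
Implicit Types (x : 'rV[R]_d) (t r : R).

Lemma lebesgue_rV_ball x r : 0 < r -> mu (ball x r) = ((r *+ 2) ^+ d)%:E.
Proof.
move=> r0.
rewrite (_ : ball x r = [set v | forall i, ball (x ord0 i) r (v ord0 i)]).
  rewrite (@lebesgue_rV_box _ _ (fun i => ball (x ord0 i) r)).
    under eq_bigr do rewrite lebesgue_measure_ball ?(ltW r0)//.
    by rewrite prodEFin prodr_const card_ord.
  by move=> i; exact: measurable_ball.
apply/seteqP; split => [z [_ xz] i|z xz]; first exact: xz.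
by split => // i j; rewrite (ord1 i); exact: xz.
Qed.

(** The sup-norm ball of radius [t / d.+1] lies in the Euclidean one, and this shrinking divides the
    volume by [d.+1 ^ d]. *)
Lemma lebesgue_rV_ball_le_eball x t : 0 < t ->
  (mu (ball x t) <= (d.+1%:R ^+ d)%:E * mu (eball x t))%E.
Proof.
move=> t0; have td0 : 0 < t / d.+1%:R by rewrite divr_gt0.
rewrite (@le_trans _ _ ((d.+1%:R ^+ d)%:E * mu (ball x (t / d.+1%:R)))%E)//.
  rewrite !lebesgue_rV_ball// -EFinM lee_fin -exprMn.
  by rewrite mulrnAr mulrCA divff ?mulr1.
rewrite lee_wpmul2l ?lee_fin ?exprn_ge0// le_measure ?inE//.
- exact: measurable_ball_rV.
- exact: measurable_eball.
- exact: ball_sub_eball.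
Qed.

Lemma lebesgue_rV_eball_gt0 x t : 0 < t -> (0 < mu (eball x t))%E.
Proof.
move=> t0; have td0 : 0 < t / d.+1%:R by rewrite divr_gt0.
apply: (@lt_le_trans _ _ (mu (ball x (t / d.+1%:R)))).
  by rewrite lebesgue_rV_ball// lte_fin exprn_gt0// pmulrn_lgt0.
rewrite le_measure ?inE//; first exact: measurable_ball_rV.
- exact: measurable_eball.
- exact: ball_sub_eball.
Qed.

Lemma lebesgue_rV_eball_lty x t : 0 < t -> (mu (eball x t) < +oo)%E.
Proof.
move=> t0; apply: (@le_lt_trans _ _ (mu (ball x t))).
  rewrite le_measure ?inE//; first exact: measurable_eball.
  - exact: measurable_ball_rV.
  - exact: eball_sub_ball.
by rewrite lebesgue_rV_ball// ltry.
Qed.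

End volume.

(** * Lower semicontinuity and measurability of the maximal function *)

Section maximal_function.
Context {R : realType} {d : nat}.
Local Notation mu := (@lebesgue_rV R d).
Variable h : 'rV[R]_d -> R.
Hypothesis mh : measurable_fun [set: 'rV[R]_d] h.
Implicit Types (x y : 'rV[R]_d) (t a : R).
Local Open Scope ereal_scope.

Let mabs : measurable_fun [set: 'rV[R]_d] (fun z => `|h z|%:E).
Proof. by apply/measurable_EFinP; exact: measurableT_comp. Qed.

(** Balls of positive radius have positive finite volume, so the division in each average can be
    cleared. *)
Lemma HL_maximal_rV_gtP x a : a%:E < HL_maximal_rV h x <->
  exists2 t, (0 < t)%R &
    a%:E * mu (eball x t) < \int[mu]_(z in eball x t) `|h z|%:E.
Proof.
have volE t : (0 < t)%R -> exists2 r, (0 < r)%R & mu (eball x t) = r%:E.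
  move=> t0; have := lebesgue_rV_eball_gt0 x t0.
  have := lebesgue_rV_eball_lty x t0.
  by case: (mu _) => [r|//|//] _; rewrite lte_fin => r0; exists r.
split=> [/ereal_sup_gt[_ [t + <-]]|[t t0 aI]].
  rewrite /= in_itv/= andbT => t0 at_; exists t => //; move: at_.
  have [r r0 ->] := volE t t0.
  by rewrite inver gt_eqF// lte_pdivlMl// muleC.
apply: (@lt_le_trans _ _ ((mu (eball x t))^-1 *
    \int[mu]_(z in eball x t) `|h z|%:E)); last first.
  by apply: ereal_sup_ubound; exists t => //=; rewrite in_itv/= t0.
move: aI; have [r r0 ->] := volE t t0.
by rewrite inver gt_eqF// lte_pdivlMl// muleC.
Qed.

Lemma HL_maximal_rV_ge0 x : 0 <= HL_maximal_rV h x.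
Proof.
apply: (@le_trans _ _ ((mu (eball x 1))^-1 *
    \int[mu]_(z in eball x 1) `|h z|%:E)).
  by rewrite mule_ge0 ?inve_ge0// integral_ge0// => z _; rewrite lee_fin.
by apply: ereal_sup_ubound; exists 1%R => //=; rewrite in_itv/= ltr01.
Qed.

(** The radii increase to [t]; the shift [n.+2] keeps them positive already at [n = 0]. *)
Lemma bigcup_eball x t : (0 < t)%R ->
  eball x t = \bigcup_n eball x (t - t / n.+2%:R)%R.
Proof.
move=> t0; apply/seteqP; split=> [z xzt|z [n _]]; last first.
  rewrite /eball/= => /lt_le_trans; apply.
  by rewrite gerBl divr_ge0// ltW.
move: xzt; rewrite /eball/= -subr_gt0 => e0.
exists (Num.truncn (t / (t - enorm (z - x)))) => //=.
rewrite ltrBrDl -ltrBrDr ltr_pdivrMr// mulrC -ltr_pdivrMr//.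
by rewrite (lt_trans (truncnS_gt _))// ltr_nat.
Qed.

(** By monotone convergence, a slightly smaller ball around [x] still carries an integral above [a]
    times the volume of the original ball. The gap between the two radii leaves room to move the
    center. *)
Lemma open_HL_maximal_rV_gt a : open [set x | a%:E < HL_maximal_rV h x].
Proof.
(* For negative [a] the set is the whole space; afterwards [0 <= a] makes multiplication by [a]
   monotone. *)
have [a0|a0] := ltP a 0%R.
  rewrite (_ : [set x | _] = setT); first exact: openT.
  apply/seteqP; split => // x _ /=.
  by rewrite (lt_le_trans _ (HL_maximal_rV_ge0 x))// lte_fin.
rewrite openE => x /HL_maximal_rV_gtP[t t0 aI].
pose F n := eball x (t - t / n.+2%:R)%R.
have ndF : nondecreasing_seq F.
  apply/nondecreasing_seqP => n; rewrite subsetEset => z.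
  rewrite /F/eball/= => /lt_le_trans; apply.
  by rewrite lerB// ler_pM2l// lef_pV2 ?posrE// ler_nat.
have mF n : measurable (F n) by exact: measurable_eball.
have mFh n : measurable_fun (F n) (fun z => `|h z|%:E) by exact: measurable_funTS.
have h0 n z : F n z -> 0 <= `|h z|%:E by rewrite lee_fin.
have cvgF := @ge0_nondecreasing_set_cvg_integral _ _ _ F _ mu ndF mF mFh h0.
have supF := ereal_nondecreasing_cvgn
  (@ge0_nondecreasing_set_nondecreasing_integral _ _ _ F _ mu ndF mF mFh h0).
have [n aF] : exists n, a%:E * mu (eball x t) < \int[mu]_(z in F n) `|h z|%:E.
  move: aI; rewrite (bigcup_eball x t0).
  rewrite -(cvg_lim _ cvgF)// (cvg_lim _ supF)//.
  by move=> /ereal_sup_gt[_ [n _ <-]] aF; exists n.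
set s := (t - t / n.+2%:R)%R in aF *.
(* Half of the gap [t - s]: for [y] within [e] of [x], the ball of radius [s + e] around [y]
   contains [eball x s] and lies in [eball x t]. *)
pose e := (t / n.+2%:R / 2)%R.
have e0 : (0 < e)%R by rewrite !divr_gt0.
have s0 : (0 < s)%R.
  by rewrite subr_gt0 ltr_pdivrMr// ltr_pMr// ltr1n.
have sE : (s + e + e)%R = t by rewrite /s /e; field.
apply/nbhs_ballP; exists (e / d.+1%:R)%R => /=; first by rewrite divr_gt0.
move=> y /(ball_sub_eball e0); rewrite /eball/= => yxe.
apply/HL_maximal_rV_gtP; exists (s + e)%R; first exact: addr_gt0.
apply: (@le_lt_trans _ _ (a%:E * mu (eball x t))).
  rewrite lee_wpmul2l ?lee_fin// le_measure ?inE//; [exact: measurable_eball..|].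
  by apply: eball_subset; rewrite -sE addrC lerD2l ltW.
apply: (lt_le_trans aF); apply: ge0_subset_integral => //.
- exact: measurable_eball.
- exact: measurable_funTS.
- by apply: eball_subset; rewrite enorm_distC addrC lerD2l ltW.
Qed.

Lemma measurable_HL_maximal_rV :
  measurable_fun [set: 'rV[R]_d] (HL_maximal_rV h).
Proof.
apply: (measurability _ (ErealGenOInfty.measurableE R)).
move=> /= _ [_ [a ->]] <-; rewrite setTI; apply: open_measurable_rV.
by rewrite preimage_itvoy; exact: open_HL_maximal_rV_gt.
Qed.

End maximal_function.

(** * Vitali covering by balls on which [f] has a large average *)

Section vitali_covering.
Context {R : realType} {d : nat}.
Local Notation mu := (@lebesgue_rV R d).
Variable f : 'rV[R]_d -> \bar R.
Hypotheses (mf : measurable_fun [set: 'rV[R]_d] f) (f0 : forall x, (0 <= f x)%E).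
Variable b : R.
Hypothesis b0 : 0 < b.
Implicit Types (p q : 'rV[R]_d * R) (s : seq ('rV[R]_d * R)).
Local Open Scope ereal_scope.

Let pball p := ball p.1 p.2.

Let heavy p := (0 < p.2)%R /\ b%:E * mu (pball p) <= \int[mu]_(z in pball p) f z.

Let U s := \bigcup_(p in [set` s]) pball p.

Let mpball p : measurable (pball p).
Proof. exact: measurable_ball_rV. Qed.

Let mU s : measurable (U s).
Proof. by apply: fin_bigcup_measurable => // p _; exact: mpball. Qed.

Let ex_max_radius s : s != [::] ->
  exists2 p, p \in s & forall q, q \in s -> (q.2 <= p.2)%R.
Proof.
elim: s => // p [|r s] IH _.
  by exists p; rewrite ?mem_head// => q; rewrite inE => /eqP ->.
have [//|p' p's p'max] := IH.
have [pp'|p'p] := leP p.2 p'.2.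
- exists p'; first by rewrite inE p's orbT.
  by move=> q; rewrite inE => /predU1P[->//|]; exact: p'max.
- exists p; first by rewrite mem_head.
  move=> q; rewrite inE => /predU1P[->//|/p'max qp'].
  by rewrite (le_trans qp')// ltW.
Qed.

(* Remove a ball of maximal radius and all those meeting it: the latter lie in
   the ball with the same center and thrice the radius. *)
Lemma vitali_covering_finite s : (forall p, p \in s -> heavy p) ->
  b%:E * mu (U s) <= (3 ^+ d)%:E * \int[mu]_(z in U s) f z.
Proof.
(* The induction is on the length, because it is applied to a filtered list and not to the tail. *)
have [n] := ubnP (size s); elim: n => // n IH in s *; rewrite ltnS => sn sh.
have mfD D : measurable_fun D f by exact: measurable_funTS.
have [->|s0] := eqVneq s [::].
  rewrite /U set_nil bigcup_set0 measure0 mule0.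
  by rewrite integral_set0 mule0.
have [p ps pmax] := ex_max_radius s0; have [p0 ph] := sh _ ps.
pose s' := [seq q <- s | `[< pball q `&` pball p = set0 >]].
have s's : (size s' < n)%N.
  (* The filter drops [p] itself: its ball contains its center, hence meets itself. *)
  apply: leq_trans sn; rewrite size_filter ltn_neqAle count_size andbT -all_count.
  apply/negP => /allP/(_ _ ps)/asboolP; rewrite setIid => /seteqP[+ _].
  by move=> /(_ p.1); apply; exact: ballxx.
have s'h q : q \in s' -> heavy q by rewrite mem_filter => /andP[_ /sh].
have {}IH := IH _ s's s'h.
have Us3 : U s `<=` ball p.1 (p.2 *+ 3) `|` U s'.
  move=> z [q /= qs qz].
  have [qp|/eqP/set0P[w [qw pw]]] := pselect (pball q `&` pball p = set0).
    by right; exists q => //=; rewrite mem_filter qs andbT; apply/asboolP.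
  (* Going from [p.1] to [w], to [q.1], to [z] costs less than [p.2 + q.2 + q.2], at most [p.2 *+ 3]
     by maximality. *)
  left; rewrite mulrS addrC mulr2n -addrA.
  have := ball_triangle pw (ball_triangle (ball_sym qw) qz).
  by apply: le_ball; rewrite lerD2l lerD// pmax.
have Us's : pball p `|` U s' `<=` U s.
  move=> z [pz|[q /= + qz]]; first by exists p.
  by rewrite mem_filter => /andP[_ qs]; exists q.
have dis : [disjoint pball p & U s'].
  rewrite disj_set2E; apply/eqP; rewrite -subset0 => z [pz [q /=]].
  rewrite mem_filter => /andP[/asboolP qp0 _] qz.
  by have : set0 z by rewrite -qp0.
apply: (@le_trans _ _ (b%:E * (mu (ball p.1 (p.2 *+ 3)) + mu (U s')))).
  rewrite lee_wpmul2l ?lee_fin ?(ltW b0)//.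
  apply: (@le_trans _ _ (mu (ball p.1 (p.2 *+ 3) `|` U s'))).
    rewrite le_measure ?inE//; apply: measurableU => //.
    exact: measurable_ball_rV.
  by apply: measureU2 => //; exact: measurable_ball_rV.
rewrite ge0_muleDr//.
(* Heaviness of [p] pays for the tripled ball and the induction hypothesis for [U s']; disjointness
   lets the two integrals add up. *)
apply: (@le_trans _ _ ((3 ^+ d)%:E * \int[mu]_(z in pball p `|` U s') f z)).
  rewrite ge0_integral_setU//.
  rewrite ge0_muleDr ?integral_ge0// leeD//.
  apply: le_trans (lee_wpmul2l _ ph); last by rewrite lee_fin exprn_ge0.
  rewrite /pball !lebesgue_rV_ball ?pmulrn_lgt0// -!EFinM lee_fin.
  by rewrite mulrnAC -[(_ *+ 3)%R]mulr_natl exprMn mulrCA.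
rewrite lee_wpmul2l ?lee_fin ?exprn_ge0//.
by apply: ge0_subset_integral => //; exact: measurableU.
Qed.

(** The finite bound does not depend on the number of balls, so it passes to the limit by continuity
    of the measure from below. *)
Lemma vitali_covering_countable (I : countType) (B : I -> 'rV[R]_d * R)
    (P : set I) : (forall i, P i -> heavy (B i)) ->
  b%:E * mu (\bigcup_(i in P) pball (B i)) <= (3 ^+ d)%:E * \int[mu]_z f z.
Proof.
move=> Ph.
(* The balls whose index lies in [P] and has code below [n]. *)
pose s n := [seq B i | i <- pmap (@pickle_inv I) (iota 0 n) & `[< P i >]].
have sP n p : reflect (exists i, [/\ P i, (pickle i < n)%N & p = B i]) (p \in s n).
  apply: (iffP mapP) => [[i + ->]|[i [Pi ni ->]]]; last exists i => //.
    rewrite mem_filter mem_pmap => /andP[/asboolP Pi /mapP[k]].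
    rewrite mem_iota => /andP[_ kn] ki; exists i; split => //.
    by have := @pickle_invK I k; rewrite -ki/= => ->.
  rewrite mem_filter mem_pmap; apply/andP; split; first exact/asboolP.
  by apply/mapP; exists (pickle i); rewrite ?pickleK_inv// mem_iota.
have UE : \bigcup_(i in P) pball (B i) = \bigcup_n U (s n).
  apply/seteqP; split=> [z [i Pi iz]|z [n _ [p /= /sP[i [Pi _ ->]] iz]]].
    by exists (pickle i).+1 => //; exists (B i) => //=; apply/sP; exists i.
  by exists i.
have ndU : nondecreasing_seq (U \o s).
  move=> n m nm; rewrite subsetEset => z [p /= /sP[i [Pi ni ->]] iz].
  by exists (B i) => //=; apply/sP; exists i; split => //; exact: leq_trans nm.
have cvgU := @nondecreasing_cvg_mu _ _ _ mu (U \o s) (fun n => mU (s n))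
  (bigcup_measurable (fun n _ => mU (s n))) ndU.
rewrite UE -lee_pdivlMl// -(cvg_lim _ cvgU)//.
apply: lime_le; first by apply/cvg_ex; eexists; exact: cvgU.
apply: nearW => n /=; rewrite lee_pdivlMl//.
apply: le_trans (vitali_covering_finite _) _.
  by move=> p /sP[i [Pi _ ->]]; exact: Ph.
rewrite lee_wpmul2l ?lee_fin ?exprn_ge0//.
by apply: ge0_subset_integral.
Qed.

End vitali_covering.

(** * The weak-type inequality for the maximal function *)

Section weak_type.
Context {R : realType} {d : nat}.
Local Notation mu := (@lebesgue_rV R d).

(** Makes the covering family countable. A center within [t / 4] of [x] and a radius between
    [5 * t / 4] and [2 * t] suffice. *)
Lemma rational_ball_near (x : 'rV[R]_d) (t : R) : 0 < t ->
  exists p : 'rV[rat]_d * rat, let q : 'rV[R]_d := map_mx ratr p.1 in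
    let s : R := ratr p.2 in
    [/\ ball q s x, ball x t `<=` ball q s & s <= 2 * t].
Proof.
move=> t0; have t4 : 0 < t / 4 by rewrite divr_gt0.
have /choice[q qP] : forall i, exists q : rat, `|ratr q - x ord0 i| < t / 4 :> R.
  move=> i; have x0 : x ord0 i < x ord0 i + t / 4 by rewrite ltrDl.
  have [q] := rat_in_itvoo x0; rewrite in_itv/= => /andP[h1 h2].
  by exists q; rewrite gtr0_norm ?subr_gt0// ltrBlDl.
have [|s] := @rat_in_itvoo R (t + t / 4) (2 * t); first lra.
rewrite in_itv/= => /andP[s1 s2].
exists (\row_i q i, s) => /=.
have qx : ball (map_mx ratr (\row_i q i) : 'rV[R]_d) (t / 4) x.
  by split => // i j; rewrite (ord1 i) /ball/= !mxE; exact: qP.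
split; last exact: ltW.
- by apply: le_ball qx; lra.
- move=> z /(ball_triangle qx); apply: le_ball; lra.
Qed.

Variable h : 'rV[R]_d -> R.
Hypothesis mh : measurable_fun [set: 'rV[R]_d] h.

(** Let [f] be [|h|] cut to zero where [|h| <= b]. Then [|h| <= f + b], so a ball on which [|h|]
    averages at least [2 * b] is heavy for [f]. *)
Lemma HL_maximal_rV_weak_type (b : R) : 0 < b ->
  (b%:E * mu [set x | ((2 * d.+1%:R) ^+ d * (2 * b))%:E < HL_maximal_rV h x] <=
   (3 ^+ d)%:E * \int[mu]_(z in [set z | (b < `|h z|)%R]) `|h z|%:E)%E.
Proof.
move=> b0; pose A := [set z | b < `|h z|].
have mabs : measurable_fun [set: 'rV[R]_d] (fun z => `|h z|).
  exact: measurableT_comp.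
have mabsE D : measurable_fun D (fun z : 'rV[R]_d => `|h z|%:E).
  by apply: measurable_funTS; exact/measurable_EFinP.
have mA : measurable A.
  rewrite (_ : A = (fun z => `|h z|) @^-1` `]b, +oo[).
    by rewrite -[X in measurable X]setTI; exact: mabs.
  by apply/seteqP; split => z; rewrite /A/= in_itv/= andbT.
rewrite integral_mkcond.
set f := (f in (_ * integral _ _ f)%E).
have mf : measurable_fun [set: 'rV[R]_d] f.
  exact/(measurable_restrictT _ mA).
have f0 x : (0 <= f x)%E by apply: erestrict_ge0 => y _; rewrite lee_fin.
pose B (p : 'rV[rat]_d * rat) : 'rV[R]_d * R := (map_mx ratr p.1, ratr p.2).
pose P := [set p | 0 < (B p).2 /\ (b%:E * mu (ball (B p).1 (B p).2) <=
  \int[mu]_(z in ball (B p).1 (B p).2) f z)%E].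
apply: le_trans (@vitali_covering_countable _ _ f mf f0 b b0 _ B P _); last by [].
rewrite lee_wpmul2l ?lee_fin ?(ltW b0)// le_measure ?inE//.
- by apply: open_measurable_rV; exact: open_HL_maximal_rV_gt.
- rewrite bigcup_mkcond; apply: countable_bigcupT_measurable => // p.
  by case: ifP => // _; exact: measurable_ball_rV.
move=> x /(HL_maximal_rV_gtP h)[t t0 at_].
have [p [px xp p2t]] := rational_ball_near x t0.
exists p => //; rewrite /P /=.
set q := map_mx ratr p.1 in px xp *; set s := ratr p.2 in px xp p2t *.
have s0 : 0 < s by case: px.
have mqs : measurable (ball q s) by exact: measurable_ball_rV.
split => //.
(* Passing from [ball q s] to [ball x t] costs [2 ^ d], and from there to [eball x t] costs
   [d.+1 ^ d]; the constant in the threshold absorbs both. *)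
have : ((2 * b)%:E * mu (ball q s) <=
    \int[mu]_(z in ball q s) f z + b%:E * mu (ball q s))%E.
  apply: (@le_trans _ _ (\int[mu]_(z in ball q s) `|h z|%:E)%E).
    apply: le_trans (le_trans _ (ltW at_)) _.
      rewrite (mulrC (_ ^+ d)) [in leRHS]EFinM -muleA.
      rewrite lee_wpmul2l ?lee_fin ?mulr_ge0// ?(ltW b0)//.
      rewrite exprMn EFinM -muleA.
      apply: le_trans (lee_wpmul2l _ (lebesgue_rV_ball_le_eball x t0)).
        rewrite !lebesgue_rV_ball// -EFinM lee_fin -exprMn lerXn2r ?nnegrE//.
        - by rewrite mulrn_wge0// ltW.
        - by rewrite mulr_ge0// mulrn_wge0// ltW.
        - by rewrite mulrnAr lerMn2r.
      by rewrite lee_fin exprn_ge0.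
    apply: ge0_subset_integral => //; first exact: measurable_eball.
    by apply: subset_trans xp; exact: eball_sub_ball.
  rewrite -integral_cst//= -ge0_integralD//; last 2 first.
  - exact: measurable_funTS.
  - by move=> z _; rewrite lee_fin ltW.
  apply: ge0_le_integral => //.
  - by apply: emeasurable_funD => //; exact: measurable_funTS.
  move=> z _; rewrite /f patchE; case: ifPn => [_|].
    by rewrite leeDl// lee_fin ltW.
  by rewrite notin_setE /A/= add0e lee_fin => /negP; rewrite -leNgt.
(* The volume is finite, so [b] times it cancels when the integral of [f] is finite; an infinite
   integral is immediate. *)
rewrite lebesgue_rV_ball// -!EFinM.
case: (integral _ _ f) => [r| |] //=; last by rewrite !leey.
by rewrite -EFinD !lee_fin; nra.
Qed.

End weak_type.

(** * Dyadic sums against powers *)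

Section dyadic_layers.
Context {R : realType}.
Implicit Types r y : R.

Lemma ex_leX2 r : exists n, r <= 2 ^+ n.
Proof.
exists (Num.truncn r).+1; rewrite (le_trans (ltW (truncnS_gt r)))//.
by rewrite -natrX ler_nat ltnW// ltn_expl.
Qed.

(** A geometric sum is controlled by its last nonzero term, which is below [y ^ 3]; the ratio
    [8 / 7] is rounded up to 2. *)
Lemma sum_expr8_lt y n : 0 <= y ->
  \sum_(k < n) 8 ^+ k * (2 ^+ k < y)%R%:R <= 2 * y ^+ 3.
Proof.
move=> y0.
have y3 : 0 <= 2 * y ^+ 3 by rewrite mulr_ge0// exprn_ge0.
elim: n => [|n IH]; first by rewrite big_ord0.
have [ny|yn] := ltP (2 ^+ n) y; last first.
  by rewrite big_ord_recr/= ltNge yn mulr0 addr0.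
have geo : 7 * \sum_(k < n.+1) 8 ^+ k = 8 ^+ n.+1 - 1 :> R.
  by rewrite subrX1; congr (_ * _); ring.
have s8 : \sum_(k < n.+1) 8 ^+ k * (2 ^+ k < y)%R%:R <= \sum_(k < n.+1) 8 ^+ k :> R.
  by apply: ler_sum => k _; rewrite ler_piMr ?exprn_ge0// lern1 leq_b1.
have ny3 : 8 ^+ n <= y ^+ 3.
  rewrite [X in X ^+ n](_ : _ = 2 ^+ 3); last by ring.
  by rewrite exprAC lerXn2r ?nnegrE ?exprn_ge0// ltW.
apply: (le_trans s8); rewrite exprS in geo; move: geo ny3 y3.
by move: (\sum_(k < n.+1) 8 ^+ k : R) (8 ^+ n : R) (y ^+ 3) => a b c; lra.
Qed.

Local Open Scope ereal_scope.

Lemma le_nneseries_term (u : nat -> \bar R) k : (forall n, 0 <= u n) ->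
  u k <= \sum_(0 <= n <oo) u n.
Proof.
move=> u0; apply: le_trans (nneseries_lim_ge k.+1 _); last by [].
by rewrite big_nat_recr//= leeDr// sume_ge0.
Qed.

(** The summand 1 covers [y <= 1]. For finite [y] above 1, the single term with
    [2 ^ k < y <= 2 ^ k.+1] is enough. *)
Lemma poweR4_le_dyadic (y : \bar R) : 0 <= y ->
  y `^ 4 <= 1 + \sum_(0 <= k <oo) (16 ^+ k.+1 * ((2 ^+ k)%:E < y)%E%:R)%:E.
Proof.
have u0 (z : \bar R) k : 0 <= (16 ^+ k.+1 * ((2 ^+ k)%:E < z)%E%:R)%:E :> \bar R.
  by rewrite lee_fin mulr_ge0// exprn_ge0.
case: y => [r||//]; last first.
  (* At [+oo] every indicator is 1, so single terms exceed any bound. *)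
  move=> _; rewrite [X in 1 + X](_ : _ = +oo) ?leey//.
  apply/eqyP => A A0; have [n An] := ex_leX2 A.
  rewrite (le_trans _ (le_nneseries_term n (u0 +oo)))//.
  rewrite ltry mulr1 lee_fin (le_trans An)//.
  by rewrite (@le_trans _ _ (16 ^+ n))%R// ?lerXn2r ?nnegrE ?ler_nat//
    exprS ler_peMl ?exprn_ge0// ler1n.
rewrite lee_fin => r0; rewrite poweR_EFin powR_mulrn//.
have [r1|r1] := leP r 1%R.
  rewrite (@le_trans _ _ 1)//; first by rewrite lee_fin exprn_ile1.
  by rewrite leeDl// nneseries_ge0.
(* The least such [n] is positive because [r > 1]; its predecessor is the required layer. *)
have [n rn nmin] := ex_minnP (ex_leX2 r).
case: n => [|n] in rn nmin *; first by move: rn; rewrite expr0 leNgt r1.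
have nr : (2 ^+ n < r)%R by rewrite ltNge; apply/negP => /nmin; rewrite ltnn.
rewrite (le_trans _ (le_trans (le_nneseries_term n (u0 r%:E)) _))//;
  last by rewrite leeDr.
rewrite lte_fin nr mulr1 lee_fin [X in (_ <= X ^+ _)%R](_ : _ = 2 ^+ 4)%R; last by ring.
by rewrite exprAC lerXn2r ?nnegrE ?exprn_ge0.
Qed.

End dyadic_layers.

(** * Marcinkiewicz interpolation between two measures *)

Section marcinkiewicz.
Context d (T : measurableType d) {R : realType}.
Variables mu P : {measure set T -> \bar R}.
Variables (h : T -> R) (F : T -> \bar R) (C L : R).
Hypotheses (mh : measurable_fun [set: T] h) (mF : measurable_fun [set: T] F).
Hypotheses (F0 : forall x, (0 <= F x)%E) (C0 : 0 <= C) (L0 : 0 < L).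
Local Open Scope ereal_scope.
Hypothesis weak : forall b, (0 < b)%R ->
  b%:E * P [set x | (L * b)%:E < F x] <=
  C%:E * \int[mu]_(x in [set x | (b < `|h x|)%R]) `|h x|%:E.

Let A k := [set x | (2 ^+ k)%:E < F x].
Let H k := [set x | (2 ^+ k < L * `|h x|)%R].

Let mA k : measurable (A k).
Proof.
rewrite (_ : A k = F @^-1` `](2 ^+ k)%:E, +oo]).
  by rewrite -[X in measurable X]setTI; apply: mF => //; exact: emeasurable_itv.
by apply/seteqP; split => x /=; rewrite in_itv/= leey andbT.
Qed.

Let mabs : measurable_fun [set: T] (fun x => `|h x|)%R.
Proof. exact: measurableT_comp. Qed.

Let mabsE D : measurable_fun D (fun x => `|h x|%:E).
Proof. by apply: measurable_funTS; exact/measurable_EFinP. Qed.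

Let mH k : measurable (H k).
Proof.
rewrite (_ : H k = (fun x => L * `|h x|)%R @^-1` `](2 ^+ k)%R, +oo[).
  have mL : measurable_fun [set: T] (fun x => L * `|h x|)%R.
    exact: measurable_funM.
  by rewrite -[X in measurable X]setTI; exact: mL.
by apply/seteqP; split => x /=; rewrite in_itv/= andbT.
Qed.

(** The weak-type bound at [b = 2 ^ k / L], multiplied by [16 * 8 ^ k * L]: the factor [2 ^ k] of
    [b] completes [16 ^ k.+1] on the left and leaves only [8 ^ k] under the integral. *)
Let layer k : (16 ^+ k.+1)%:E * P (A k) <=
  (16 * C * L)%:E * \int[mu]_x (8 ^+ k * (x \in H k)%:R * `|h x|)%:E.
Proof.
have b0 : (0 < 2 ^+ k / L)%R by rewrite divr_gt0// exprn_gt0.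
have := weak b0.
rewrite (_ : L * _ = 2 ^+ k)%R; last by rewrite mulrC divfK ?gt_eqF.
rewrite -/(A k) (_ : [set x | _] = H k); last first.
  by apply/seteqP; split => x /=; rewrite /H/= ltr_pdivrMr// mulrC.
move=> /(lee_wpmul2l (_ : 0 <= (16 * 8 ^+ k * L)%:E)).
rewrite !muleA -!EFinM (_ : 16 * 8 ^+ k * L * (2 ^+ k / L) = 16 ^+ k.+1)%R; last first.
  rewrite exprS [X in (_ = _ * X ^+ _)%R](_ : _ = 8 * 2)%R; last by ring.
  by rewrite exprMn; field; rewrite gt_eqF.
move=> /(_ _)/le_trans; apply; first by rewrite lee_fin !mulr_ge0 ?exprn_ge0// ltW.
rewrite [X in _ <= _ * X](_ : _ = (8 ^+ k)%:E * \int[mu]_(x in H k) `|h x|%:E).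
  rewrite muleA -EFinM (_ : 16 * 8 ^+ k * L * C = 16 * C * L * 8 ^+ k)%R//.
  by ring.
rewrite [in RHS]integral_mkcond -ge0_integralZl_EFin//.
- apply: eq_integral => x _; rewrite patchE; case: ifPn => _.
    by rewrite mulr1 EFinM.
  by rewrite mulr0 mul0r mule0.
- by move=> x _; apply: erestrict_ge0 => y _; rewrite lee_fin.
- exact/(measurable_restrictT _ (mH k)).
Qed.

(* Marcinkiewicz interpolation: the weak-type bound at height [2 ^ k] only
   involves the part of [h] above [2 ^ k / L], so that the sum over [k] of
   [16 ^ k * P (A k)] is a geometric sum under the integral sign. *)
Lemma weak_type_integral_poweR4_lty : P [set: T] < +oo ->
  \int[mu]_x (`|h x| ^+ 4)%:E < +oo -> \int[P]_x F x `^ 4 < +oo.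
Proof.
move=> Pfin h4.
have mAk k : measurable_fun [set: T] (fun x => (16 ^+ k.+1)%:E * (\1_(A k) x)%:E).
  by apply: measurable_funeM; apply/measurable_EFinP; exact: measurable_indic.
have A0 k x : 0 <= (16 ^+ k.+1)%:E * (\1_(A k) x)%:E.
  by rewrite mule_ge0// lee_fin// exprn_ge0.
apply: (@le_lt_trans _ _ (\int[P]_x
    (1 + \sum_(0 <= k <oo) (16 ^+ k.+1)%:E * (\1_(A k) x)%:E))).
  apply: ge0_le_integral => //.
  - by move=> x _; exact: poweR_ge0.
  - by apply: (measurableT_comp (measurable_poweR 4)).
  - apply: emeasurable_funD => //.
    apply: ge0_emeasurable_sum => // k x _ _; exact: A0.
  - move=> x _; apply: le_trans (poweR4_le_dyadic (F0 x)) _.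
    rewrite leeD2l//; apply: lee_nneseries => [k _ _|k _].
      by rewrite lee_fin mulr_ge0// exprn_ge0.
    rewrite indicE EFinM (_ : (x \in A k) = ((2 ^+ k)%:E < F x))//.
    by apply/idP/idP; rewrite inE.
rewrite ge0_integralD//; last 2 first.
- by move=> x _; exact: nneseries_ge0.
- by apply: ge0_emeasurable_sum => // k x _ _; exact: A0.
(* Finiteness of [P] disposes of the summand 1. *)
rewrite integral_cst// mul1e lte_add_pinfty//.
rewrite integral_nneseries//.
pose g k x := (8 ^+ k * (x \in H k)%:R * `|h x|)%:E.
have g0 k x : 0 <= g k x by rewrite lee_fin !mulr_ge0// exprn_ge0.
have mg k : measurable_fun [set: T] (g k).
  apply/measurable_EFinP; apply: measurable_funM => //.
  by apply: measurable_funM => //; exact: (measurable_indic (mH k)).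
have D0 : (0 <= 16 * C * L)%R by rewrite !mulr_ge0// ltW.
apply: (@le_lt_trans _ _ (\sum_(0 <= k <oo)
    ((16 * C * L)%:E * \int[mu]_x g k x))).
  apply: lee_nneseries => [k _ _|k _].
    by apply: integral_ge0 => x _; exact: A0.
  rewrite ge0_integralZl_EFin// ?exprn_ge0//; last first.
    by apply/measurable_EFinP; exact: measurable_indic.
  by rewrite integral_indic// setIT; exact: layer.
rewrite nneseriesZl => [|k _]; last by apply: integral_ge0 => x _; exact: g0.
rewrite lte_mul_pinfty//.
rewrite -integral_nneseries//.
(* Pointwise, the sum of [8 ^ k] over [2 ^ k < L * |h|] is at most [2 * (L * |h|) ^ 3]; the
   remaining factor [|h|] gives the fourth power. *)
apply: (@le_lt_trans _ _ (\int[mu]_x ((2 * L ^+ 3)%:E * (`|h x| ^+ 4)%:E))).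
  apply: ge0_le_integral => //.
  - by move=> x _; exact: nneseries_ge0.
  - by apply: ge0_emeasurable_sum => // k x _ _; exact: g0.
  - by apply: measurable_funeM; apply/measurable_EFinP; exact: measurable_funX.
  move=> x _; apply: lime_le; first exact: is_cvg_nneseries.
  apply: nearW => n; rewrite big_mkord sumEFin -EFinM lee_fin -mulr_suml.
  rewrite (exprSr _ 3) mulrA ler_wpM2r//.
  have Lh0 : (0 <= L * `|h x|)%R by rewrite mulr_ge0// ltW.
  under eq_bigr => k _.
    rewrite (_ : (x \in H k) = (2 ^+ k < L * `|h x|)%R); last first.
      by apply/idP/idP; rewrite inE.
    over.
  by rewrite (le_trans (sum_expr8_lt n Lh0))// exprMn mulrA.
rewrite ge0_integralZl_EFin//.
- by rewrite lte_mul_pinfty// lee_fin mulr_ge0// exprn_ge0// ltW.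
- by apply/measurable_EFinP; exact: measurable_funX.
- by rewrite mulr_ge0// exprn_ge0// ltW.
Qed.

End marcinkiewicz.

(** * Integral bounds drawn from membership in L^oo and L^4 *)

Lemma Lfun_y_integral_le d (T : measurableType d) (R : realType)
    (mu : {measure set T -> \bar R}) (rho : T -> R) :
  (0 < mu [set: T])%E -> rho \in Lfun mu +oo%E ->
  exists2 K : R, 0 <= K & forall A, measurable A ->
    (\int[mu]_(x in A) (rho x)%:E <= K%:E * mu A)%E.
Proof.
move=> muT /andP[/set_mem mrho /set_mem/=]; rewrite /finite_norm => rhoy.
have rho0 := Lnorm_ge0 mu +oo%E (EFin \o rho).
have mE D : measurable_fun D (EFin \o rho).
  by apply: measurable_funTS; exact/measurable_EFinP.
exists (fine 'N[mu]_+oo[EFin \o rho]); first exact: fine_ge0.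
move=> A mA; set K := fine _.
have rhoK : {ae mu, forall x, A x -> (`|rho x|%:E <= K%:E)%E}.
  rewrite /K fineK ?ge0_fin_numE//.
  (* Positive total mass selects the essential supremum in the definition of the norm. *)
  rewrite unlock muT; apply: filterS (ess_sup_ge mu (abse \o (EFin \o rho))).
  by move=> x + _.
apply: (le_trans (lee_abs _)); apply: le_trans (le_abse_integral mu mA (mE A)) _.
rewrite -integral_cst//; apply: ae_ge0_le_integral => //.
- exact: measurableT_comp.
- by move=> x _; rewrite lee_fin fine_ge0.
Qed.

Lemma Lfun4_integral_lty d (T : measurableType d) (R : realType)
    (mu : {measure set T -> \bar R}) (h : T -> R) : h \in Lfun mu 4%:E ->
  measurable_fun [set: T] h /\ (\int[mu]_x (`|h x| ^+ 4)%:E < +oo)%E.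
Proof.
move=> /andP[/set_mem mh /set_mem/=]; rewrite /finite_norm => hy; split => //.
under eq_integral do rewrite -powR_mulrn// -poweR_EFin.
have := @poweR_Lnorm _ _ _ mu (EFin \o h) 4.
by move=> <-//; rewrite poweR_lty.
Qed.

(** * The L^4 bound under a bounded density, and the theorem *)

Section maximal_function_L4.
Context {R : realType} {d : nat}.
Local Notation mu := (@lebesgue_rV R d).

(** The density bound [P A <= K * mu A] transfers the weak-type inequality to [P], with
    [C = K * 3 ^ d] and [L = (2 * d.+1) ^ d * 2]; interpolation does the rest. *)
Lemma HL_maximal_rV_eLfun4 (P : {measure set 'rV[R]_d -> \bar R})
    (rho h : 'rV[R]_d -> R) : (P setT < +oo)%E -> rho \in Lfun mu +oo%E ->
  (forall A, measurable A -> P A = \int[mu]_(x in A) (rho x)%:E)%E ->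
  h \in Lfun mu 4%:E -> eLfun P 4%:E (HL_maximal_rV h).
Proof.
move=> Pfin rhoy Prho /Lfun4_integral_lty[mh h4].
have muT : (0 < mu [set: 'rV[R]_d])%E.
  apply: lt_le_trans (@lebesgue_rV_eball_gt0 R d 0 1 ltr01) _.
  by rewrite le_measure ?inE//; exact: measurable_eball.
have [K K0 rhoK] := Lfun_y_integral_le muT rhoy.
have mM := measurable_HL_maximal_rV mh.
split => //; rewrite unlock poweR_lty//.
have L0 : 0 < (2 * d.+1%:R) ^+ d * 2 :> R.
  by rewrite mulr_gt0// exprn_gt0// mulr_gt0.
under eq_integral do rewrite gee0_abs ?HL_maximal_rV_ge0//.
apply: (@weak_type_integral_poweR4_lty _ _ _ mu P h _ (K * 3 ^+ d) _ mh mM _ _ L0) => //.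
- exact: HL_maximal_rV_ge0.
- by rewrite mulr_ge0// exprn_ge0.
- move=> b b0.
  have mA : measurable [set x | (((2 * d.+1%:R) ^+ d * 2 * b)%:E < HL_maximal_rV h x)%E].
    by apply: open_measurable_rV; exact: open_HL_maximal_rV_gt.
  rewrite Prho//; apply: le_trans (lee_wpmul2l _ (rhoK _ mA)) _.
    by rewrite lee_fin ltW.
  rewrite muleCA (EFinM K) -muleA lee_wpmul2l// -mulrA.
  exact: HL_maximal_rV_weak_type.
Qed.

End maximal_function_L4.

Theorem proposition5 (R : realType) (d : nat)
    (pi : probability 'rV[R]_d R) (rho : 'rV[R]_d -> R) (g : 'rV[R]_d -> R)
    (rho_Linfty : rho \in Lfun (lebesgue_rV d) +oo%E)
    (pi_density : forall A : set 'rV[R]_d, measurable A ->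
      pi A = (\int[lebesgue_rV d]_(x in A) (rho x)%:E)%E)
    (g_C1 : C1 g)
    (g_L20 : L20 pi g)
    (grad_L4 : (enorm \o grad g) \in Lfun (lebesgue_rV d) 4%:E) :
  eLfun pi 4%:E (HL_maximal_rV (enorm \o grad g)) /\ G_grad pi g.
Proof.
have pi_lty : (pi setT < +oo)%E by rewrite probability_setT ltry.
have M4 := HL_maximal_rV_eLfun4 pi_lty rho_Linfty pi_density grad_L4.
by split.
Qed.
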